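(* Let $\varphi:(Z,\beta)\to(Z',\beta')$ be an $O(u)$-quasisymmetric homeomorphism and let $\Gamma$, resp. $\Gamma'$, be a family of subsets of $Z$, resp. $Z'$, such that $\Gamma'=\{\varphi(\gamma):\gamma\in\Gamma\}$. Then $$\operatorname{Cdim}^{\Gamma}_{O(u)}(\beta)=\operatorname{Cdim}^{\Gamma'}_{O(u)}(\beta')\quad\text{and}\quad \operatorname{PCdim}^{\Gamma}_{O(u)}(\beta)=\operatorname{PCdim}^{\Gamma'}_{O(u)}(\beta').$$
   Context: Throughout, $u:\mathbb{R}_{\ge0}\to\mathbb{R}_{\ge1}$ is nondecreasing, $u(r)/r\to0$ as $r\to+\infty$, and $\sup_r u(2r)/u(r)<\infty$. $O(u)$-quasisymmetric structure on a set $Z$: a set $\beta$ (abstract balls) with a realization map $\beta\to\mathcal{P}(Z)\setminus\{\emptyset\}$, $b\mapsto\widehat b$, a map $\delta:\beta\to\mathbb{Z}$ and a shift $\mathbb{Z}_{\ge0}\times\beta\to\beta$, $(k,b)\mapsto k.b$, such that: (SC0) $k'.k.b=(k'+k).b$ and $\delta(k.b)=\delta(b)-k$; (SC1) for all $k\in\mathbb{Z}_{\ge0}$, $b,b'\in\beta$: (i) $\widehat{k.b}\supseteq\widehat b$; (ii) $\widehat b\subseteq\widehat{b'}$ implies $\widehat{k.b}\subseteq\widehat{k.b'}$; (iii) $\delta(b)<\delta(b')$ implies $\widehat b\nsubseteq\widehat{b'}$; (SC2) there are $n_0\in\mathbb{Z}_{\ge0}$ and $q:\mathbb{Z}_{\ge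 n_0}\to\mathbb{Z}_{\ge0}$, $q=O(u)$, such that $n_0\le\delta(b)\le\delta(b')$ and $\widehat b\cap\widehat{b'}\ne\emptyset$ imply $\widehat{q(\delta(b)).b}\supset\widehat{b'}$; (SC3) for all $x\ne y$ in $Z$ and $n\in\mathbb{Z}$ there is $b\in\beta$ with $\delta(b)\ge n$, $x\in\widehat b$, $y\notin\widehat b$. $\mathcal{O}^+(u)$: germs at $+\infty$ of functions $v=O(u)$ with values in $\mathbb{Z}_{\ge0}$, defined on large enough integers. For $\delta(b)$ in the domain of $v$, $v.b:=v(\delta(b)).b$. Round sets, rings, outer rings: for $k,j\in\mathcal{O}^+(u)$, $n\in\mathbb{Z}$: $a\subseteq Z$ is a $(k,n)$-round set if $\widehat b\subseteq a\subseteq\widehat{k.b}$ for some $b\in\beta$ with $\delta(b)\ge n$; $(a^-,a^+)\in\mathcal{P}(Z)^2$ is a $(k,n)$-ring if $\widehat b\subseteq a^-\subseteq a^+\subseteq\widehat{k.b}$ for some $b\in\beta$ with $\delta(b)\ge n$, and a $(j,n)$-outer ring if $a^-\subseteq\widehat b\subseteq\widehat{j.b}\subseteq a^+$ for some $b\in\beta$ with $\delta(b)\ge n$. The respective sets are $\mathscr{B}^k_n(\beta)$, $\mathscr{R}^k_n(\beta)$, $\mathscr{O}_{j;n}(\beta)$; $\mathscr{R}^k(\beta)$ is the union of $\mathscr{R}^k_n(\beta)$ over $n$ in the domain of $k$. Equivalence, homeomorphisms: for two structures $\beta,\beta'$ on $Z$, $\beta'$ is finer than $\beta$ if there are $\lambda>0$,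 $n_0\in\mathbb{Z}$ such that $\forall k\in\mathcal{O}^+(u)\,\exists k'\in\mathcal{O}^+(u)\,\forall n\ge n_0$: $\mathscr{R}^k_n(\beta)\subseteq\mathscr{R}^{k'}_{\lfloor\lambda n\rfloor}(\beta')$, and $\forall j'\in\mathcal{O}^+(u)\,\exists j\in\mathcal{O}^+(u)\,\forall n\ge n_0$: $\mathscr{O}_{j;n}(\beta)\subseteq\mathscr{O}_{j';\lfloor\lambda n\rfloor}(\beta')$. They are equivalent if each is finer than the other. A bijection $\varphi:Z\to Z'$ is an $O(u)$-quasisymmetric homeomorphism if $\beta$ and the pull-back $\varphi^*\beta'$ (same abstract balls as $\beta'$, realizations $\varphi^{-1}(\widehat{b'})$) are equivalent. Gauges: a gauge is any function $\phi:\mathcal{P}(Z)\to[0,\infty)$; $\widetilde\phi^\ell(a)=\sup\{\phi(\widetilde a):(a,\widetilde a)\in\mathscr{R}^\ell(\beta)\}$ ($0$ if the set is empty). $\Phi_{p;k}(A)=\lim_{n\to\infty}\inf\sum_{b\in\mathscr{F}}\phi(b)^p$, $\widetilde\Phi^\ell_{p;k}(A)=\lim_{n\to\infty}\inf\sum_{b\in\mathscr{F}}\widetilde\phi^\ell(b)^p$, infima over countable $\mathscr{F}\subset\mathscr{B}^k_n(\beta)$ covering $A\subseteq Z$. A $(k,n)$-packing centered on $A$ is a countable collection $\mathscr{P}$ of $(k,n)$-outer rings $\mathbf a=(a^-,a^+)$ with $a^-\cap A\neq\emptyset$ for every member and with pairwise disjoint outer sets $a^+$ for distinct members; $\mathrm{P}\widetilde\Phi^\ell_{p;k}(A)=\lim_{n\to\infty}\sup_{\mathscr{P}}\sum_{\mathbf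 a\in\mathscr{P}}\widetilde\phi^\ell(a^-)^p$, supremum over such packings ($0$ if there is none). Moduli: $\mathcal{G}_m(\Gamma,\beta)$ is the set of gauges with $\Phi_{1;m}(\gamma)\ge1$ for all $\gamma\in\Gamma$; $\operatorname{mod}^{\ell,m}_{p;k}(\Gamma,\beta)=\inf_{\phi\in\mathcal{G}_m(\Gamma,\beta)}\widetilde\Phi^\ell_{p;k}(Z)$, $\operatorname{pmod}^{\ell,m}_{p;k}(\Gamma,\beta)=\inf_{\phi\in\mathcal{G}_m(\Gamma,\beta)}\mathrm{P}\widetilde\Phi^\ell_{p;k}(Z)$. Conformal dimensions: $\operatorname{Cdim}^\Gamma_{O(u)}(\beta)=\sup\{p>0:\forall k\in\mathcal{O}^+(u)\,\exists\ell,m\in\mathcal{O}^+(u),\ \operatorname{mod}^{\ell,m}_{p;k}(\Gamma,\beta)=+\infty\}$ (or $0$ if the set is empty); $\operatorname{PCdim}^\Gamma_{O(u)}(\beta)$ is defined in the same way with $\operatorname{pmod}$ in place of $\operatorname{mod}$. *)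

(* Defs.v *)
From HB Require Import structures.
From mathcomp Require Import all_boot all_order all_algebra.
From mathcomp Require Import all_classical all_reals all_analysis.

Set Implicit Arguments.
Unset Strict Implicit.
Unset Printing Implicit Defensive.

Import Order.TTheory GRing.Theory Num.Theory.
Import numFieldNormedType.Exports.

Local Open Scope classical_set_scope.
Local Open Scope ring_scope.

(* [u] stands for a function [0, +oo[ -> [1, +oo[; its values at negative reals
   are never used. *)
Definition admissible (R : realType) (u : R -> R) : Prop :=
  [/\ forall r, 0 <= r -> 1 <= u r,
      forall r s, 0 <= r -> r <= s -> u r <= u s,
      u r / r @[r --> +oo] --> (0 : R)
    & exists M : R, forall r, 0 <= r -> u (2 * r) / u r <= M].

(* A representative of an element of O^+(u): a function on the integers
   [n >= odom], with values in nat, which is O(u) at +oo. The values of [ofun]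
   below [odom] are junk, and are never used. *)
Record Oplus (R : realType) (u : R -> R) := {
  odom : int;
  ofun :> int -> nat;
  ofun_bigO : (fun n : nat => (ofun n%:Z)%:R : R^o) =O_\oo
              (fun n : nat => u n%:R : R^o)
}.

Record qs_structure (R : realType) (u : R -> R) (Z : Type) := {
  ball_of : Type;
  hat : ball_of -> set Z;
  delta : ball_of -> int;
  shift : nat -> ball_of -> ball_of;
  hat_nonempty : forall b, hat b !=set0;
  sc0_shift : forall k' k b, shift k' (shift k b) = shift (k' + k) b;
  sc0_delta : forall k b, delta (shift k b) = delta b - k%:Z;
  sc1_i : forall k b, hat b `<=` hat (shift k b);
  sc1_ii : forall k b b', hat b `<=` hat b' ->
    hat (shift k b) `<=` hat (shift k b');
  sc1_iii : forall b b', delta b < delta b' -> ~ (hat b `<=` hat b');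
  (* the threshold n_0 is the domain bound of [q] *)
  sc2 : exists q : Oplus u, 0 <= odom q /\
    forall b b', odom q <= delta b -> delta b <= delta b' ->
      hat b `&` hat b' !=set0 -> hat b' `<=` hat (shift (q (delta b)) b);
  sc3 : forall (x y : Z) (n : int), x <> y ->
    exists b, [/\ n <= delta b, hat b x & ~ hat b y]
}.

Section RoundSets.
Variables (R : realType) (u : R -> R) (Z : Type) (B : qs_structure u Z).
Implicit Types (k : Oplus u) (n : int) (b : ball_of B).

(* [v.b] is meaningful only when [delta b] lies in the domain of [v]; this is
   required wherever [oshift] is used below. *)
Definition oshift (v : Oplus u) b : ball_of B := shift (v (delta b)) b.

Definition round_sets k n : set (set Z) :=
  [set a | exists b, [/\ n <= delta b, odom k <= delta b,
    hat b `<=` a & a `<=` hat (oshift k b)]].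

Definition rings k n : set (set Z * set Z) :=
  [set a | exists b, [/\ n <= delta b, odom k <= delta b,
    hat b `<=` a.1, a.1 `<=` a.2 & a.2 `<=` hat (oshift k b)]].

Definition outer_rings k n : set (set Z * set Z) :=
  [set a | exists b, [/\ n <= delta b, odom k <= delta b,
    a.1 `<=` hat b, hat b `<=` hat (oshift k b) & hat (oshift k b) `<=` a.2]].

Definition all_rings k : set (set Z * set Z) :=
  \bigcup_(n in [set n : int | odom k <= n]) rings k n.

End RoundSets.

Section Equivalence.
Variables (R : realType) (u : R -> R) (Z : Type).
Implicit Types B : qs_structure u Z.

Definition finer B' B : Prop :=
  exists (lambda : R) (n0 : int), [/\ 0 < lambda,
    forall k : Oplus u, exists k' : Oplus u, forall n : int, n0 <= n ->
      rings B k n `<=` rings B' k' (Num.floor (lambda * n%:~R))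
  & forall j' : Oplus u, exists j : Oplus u, forall n : int, n0 <= n ->
      outer_rings B j n `<=` outer_rings B' j' (Num.floor (lambda * n%:~R))].

Definition equivalent B B' : Prop := finer B' B /\ finer B B'.

End Equivalence.

Section Pullback.
Variables (R : realType) (u : R -> R) (Z Z' : Type) (phi : Z -> Z').
Hypothesis phi_bij : bijective phi.
Variable B' : qs_structure u Z'.

Let phat (b : ball_of B') : set Z := phi @^-1` hat b.

Let phatS b b' : phat b `<=` phat b' <-> hat b `<=` hat b'.
Proof.
case: phi_bij => psi _ psiK; split=> [sub y yb|sub x]; last exact: sub.
by have := sub (psi y); rewrite /phat /preimage /= psiK; exact.
Qed.

Lemma pullback_nonempty b : phat b !=set0.
Proof.
case: phi_bij => psi _ psiK; have [y yb] := hat_nonempty b.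
by exists (psi y); rewrite /phat /preimage /= psiK.
Qed.

Lemma pullback_sc1_i k b : phat b `<=` phat (shift k b).
Proof. by apply/phatS; exact: sc1_i. Qed.

Lemma pullback_sc1_ii k b b' : phat b `<=` phat b' ->
  phat (shift k b) `<=` phat (shift k b').
Proof. by move=> /phatS bb'; apply/phatS; exact: sc1_ii. Qed.

Lemma pullback_sc1_iii b b' : delta b < delta b' -> ~ (phat b `<=` phat b').
Proof. by move=> lt_bb' /phatS; exact: sc1_iii. Qed.

Lemma pullback_sc2 : exists q : Oplus u, 0 <= odom q /\
  forall b b' : ball_of B', odom q <= delta b -> delta b <= delta b' ->
    phat b `&` phat b' !=set0 -> phat b' `<=` phat (shift (q (delta b)) b).
Proof.
have [q [q0 Hq]] := sc2 B'; exists q; split=> // b b' qb bb' [x [xb xb']].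
by apply/phatS; apply: Hq => //; exists (phi x).
Qed.

Lemma pullback_sc3 (x y : Z) (n : int) : x <> y ->
  exists b, [/\ n <= delta b, phat b x & ~ phat b y].
Proof.
move=> xy; have /(sc3 B' n)[b [nb xb yb]] : phi x <> phi y.
  by move=> /(bij_inj phi_bij).
by exists b.
Qed.

Definition pullback : qs_structure u Z := {|
  ball_of := ball_of B';
  hat := fun b => phi @^-1` hat b;
  delta := @delta _ _ _ B';
  shift := @shift _ _ _ B';
  hat_nonempty := pullback_nonempty;
  sc0_shift := @sc0_shift _ _ _ B';
  sc0_delta := @sc0_delta _ _ _ B';
  sc1_i := pullback_sc1_i;
  sc1_ii := pullback_sc1_ii;
  sc1_iii := pullback_sc1_iii;
  sc2 := pullback_sc2;
  sc3 := pullback_sc3 |}.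

End Pullback.

Definition qs_homeomorphism (R : realType) (u : R -> R) (Z Z' : Type)
    (B : qs_structure u Z) (B' : qs_structure u Z') (phi : Z -> Z') : Prop :=
  exists phi_bij : bijective phi, equivalent B (pullback phi_bij B').

(* For S included in [0, +oo], the supremum of S in [0, +oo]; it is 0 if S is
   empty. *)
Definition sup0 (R : realType) (S : set (\bar R)) : \bar R :=
  ereal_sup (0%E |` S).

Section Moduli.
Variables (R : realType) (u : R -> R) (Z : Type) (B : qs_structure u Z).
Implicit Types (k l m : Oplus u) (p : R) (A : set Z) (Gamma : set (set Z)).

Definition gauge := set Z -> {nonneg R}.
Implicit Type phi : gauge.

Definition tilde phi l (a : set Z) : \bar R :=
  sup0 [set ((phi a')%:num)%:E | a' in [set a' | all_rings B l (a, a')]].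

Definition coverings k (n : int) A : set (set (set Z)) :=
  [set F | [/\ countable F, F `<=` round_sets B k n
             & A `<=` \bigcup_(b in F) b]].

(* Common form of Phi and of its tilde variant: the sums are over countable
   families and of terms in [0, +oo]. The infimum is nondecreasing in n, so the
   limit exists in [0, +oo], and it may be taken along the natural numbers. *)
Definition covering_measure (f : set Z -> \bar R) p k A : \bar R :=
  limn (fun n : nat =>
    ereal_inf [set \esum_(b in F) (f b `^ p)%E | F in coverings k n%:Z A]).

Definition Phi phi p k A : \bar R :=
  covering_measure (fun b => ((phi b)%:num)%:E) p k A.

Definition tPhi phi l p k A : \bar R := covering_measure (tilde phi l) p k A.

Definition packings k (n : int) A : set (set (set Z * set Z)) :=
  [set P | [/\ countable P, P `<=` outer_rings B k n,
               forall a, P a -> a.1 `&` A !=set0 & trivIset P snd]].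

(* The supremum is nonincreasing in n, so the limit exists. *)
Definition PtPhi phi l p k A : \bar R :=
  limn (fun n : nat =>
    sup0 [set \esum_(a in P) (tilde phi l a.1 `^ p)%E | P in packings k n%:Z A]).

Definition admissible_gauges m Gamma : set gauge :=
  [set phi | forall gamma, Gamma gamma -> (1 <= Phi phi 1 m gamma)%E].

Definition modulus l m p k Gamma : \bar R :=
  ereal_inf [set tPhi phi l p k setT | phi in admissible_gauges m Gamma].

Definition pmodulus l m p k Gamma : \bar R :=
  ereal_inf [set PtPhi phi l p k setT | phi in admissible_gauges m Gamma].

Definition Cdim Gamma : \bar R :=
  sup0 [set p%:E | p in [set p : R | 0 < p /\
    forall k, exists l m, modulus l m p k Gamma = +oo%E]].

Definition PCdim Gamma : \bar R :=
  sup0 [set p%:E | p in [set p : R | 0 < p /\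
    forall k, exists l m, pmodulus l m p k Gamma = +oo%E]].

End Moduli.

(* Main.v *)
Require Import Defs.
From mathcomp Require Import all_boot all_order all_algebra.
From mathcomp Require Import all_classical all_reals all_analysis.

Set Implicit Arguments.
Unset Strict Implicit.
Unset Printing Implicit Defensive.

Import Order.TTheory GRing.Theory Num.Theory.
Import numFieldNormedType.Exports.

Local Open Scope classical_set_scope.
Local Open Scope ring_scope.

(** Except for the tilde gauges, discussed below, the moduli only involve rings
and outer rings at arbitrarily fine scales, and an equivalence of structures says that these
can be traded for one another, up to changing the germ k and rescaling the
depth n by lambda. Since all quantities are limits as n tends to infinity, the
exact rescaling is irrelevant: only the cofinal statement matters that, at any
depth n on one side, some depth N on the other side suffices
([ring_comparison], [outer_ring_comparison]). A homeomorphism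
[phi : Z -> Z'] with inverse [psi] yields such comparisons between B and B'
directly ([equivalent_pullback_comparison]), sets being carried across by
preimages. The setting is symmetric, so one inequality between the dimensions
is enough.

Let h : Y -> X be bijective, with comparisons both ways, and let p be such that
for each kX some l, m make the modulus of GammaX infinite. Given kY, every
choice of parameters is forced. The comparison from Y to X turns kY-coverings
into kX-coverings for some kX, which determines l and m; the comparison from X
to Y turns l into l' and m into m'. A gauge phi on Y is pulled back to the gauge
sending c to phi (h^-1 c).
- If phi is m'-admissible for GammaY then its pull-back is m-admissible for
  GammaX, because m-coverings in X are carried to m'-coverings in Y
  ([admissible_gauges_preimage]).
- The measure of the pull-back at (l, kX) is at most that of phi at (l', kY)
  ([tPhi_le]): fewer coverings are allowed in Y, and the tilde gauge is larger
  there since l-rings in X become l'-rings in Y.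
Hence an infinite modulus in X forces an infinite one in Y.

The last point hides the only use of the sublinearity of u. The tilde gauge at a
takes a supremum over all l-rings with inner set a, at no prescribed depth,
whereas comparisons hold only beyond some depth. But a ball contained in a small
round set is itself deep: if a lies in k.b and contains the ball c, then c is at
least as deep as k.b by [sc1_iii], so delta c >= delta b - k (delta b), which tends to infinity with
delta b ([small_round_set_ring]).

Packings behave in the same way, with outer rings instead of round sets and
suprema instead of infima, so that the comparison of outer rings is used from X
to Y, with kX obtained from kY ([PtPhi_le]). *)

(** * Suprema, limits and sums of extended reals *)

Section Limits.
Variable R : realType.
Implicit Types (S T : set (\bar R)) (s t : nat -> \bar R).
Local Open Scope ereal_scope.

Lemma sup0_le S T : (forall x, S x -> exists2 y, T y & x <= y) ->
  Defs.sup0 S <= Defs.sup0 T.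
Proof.
move=> ST; apply: ge_ereal_sup => x [->|/ST[y Ty xy]].
  by apply: ereal_sup_ubound; left.
by apply: le_trans xy _; apply: ereal_sup_ubound; right.
Qed.

Lemma sup0_ge0 S : 0 <= Defs.sup0 S.
Proof. by apply: ereal_sup_ubound; left. Qed.

Lemma limn_nondecreasing_le s t :
  {homo s : n m / (n <= m)%N >-> n <= m} ->
  {homo t : n m / (n <= m)%N >-> n <= m} ->
  (forall m, exists n, s m <= t n) -> limn s <= limn t.
Proof.
move=> s_nd t_nd st.
rewrite (cvg_lim _ (ereal_nondecreasing_cvgn s_nd))//.
rewrite (cvg_lim _ (ereal_nondecreasing_cvgn t_nd))//.
apply: ge_ereal_sup => _ [m _ <-]; have [n smn] := st m.
by apply: le_trans smn _; apply: ereal_sup_ubound; exists n.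
Qed.

Lemma limn_nonincreasing_le s t :
  {homo s : n m / (n <= m)%N >-> m <= n} ->
  {homo t : n m / (n <= m)%N >-> m <= n} ->
  (forall m, exists n, s n <= t m) -> limn s <= limn t.
Proof.
move=> s_ni t_ni st.
rewrite (cvg_lim _ (ereal_nonincreasing_cvgn s_ni))//.
rewrite (cvg_lim _ (ereal_nonincreasing_cvgn t_ni))//.
apply: le_ereal_inf_tmp => _ [m _ <-]; have [n smn] := st m.
by apply: le_trans smn; apply: ereal_inf_lbound; exists n.
Qed.

Lemma esum_powere_le (I J : choiceType) (F : set I) (e : I -> J) (p : R)
    (f : I -> \bar R) (g : J -> \bar R) :
  (0 <= p)%R -> injective e -> (forall j, 0 <= g j) ->
  (forall i, F i -> g (e i) <= f i) ->
  \esum_(j in e @` F) (g j `^ p)%E <= \esum_(i in F) (f i `^ p)%E.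
Proof.
move=> p0 e_inj g0 gf; rewrite esum_image; last by move=> ? ? _ _ /e_inj.
apply: le_esum => i Fi; apply: gt0_ler_poweR => //; last exact: gf.
  by rewrite in_itv/= g0 leey.
by rewrite in_itv/= leey andbT (le_trans _ (gf i Fi)).
Qed.

End Limits.

(** * Depths *)

Section Scales.
Variables (R : realType) (u : R -> R) (u_adm : admissible u).

(** Shifting by k loses at most O(u(n)) = o(n) in depth. *)
Lemma Oplus_sublinear (k : Oplus u) (c : int) :
  exists N : int, forall n : int, N <= n -> c <= n - (k n)%:Z.
Proof.
case: u_adm => u_ge1 _ /cvgrPdist_lt ucvg _.
have /eqO_exP[C C0 [N1 _ kC]] := ofun_bigO k.
have C2 : 0 < (2 * C)^-1 by rewrite invr_gt0 mulr_gt0.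
have [M [_ uM]] := ucvg _ C2.
(* Beyond N1, k n <= C u(n); beyond N2, u(n) <= n / (2 C); so k n <= n / 2,
   and N3 makes the remaining n / 2 at least |c|. *)
pose N2 := `|Num.ceil M|.+1%N; pose N3 := (2 * `|c|)%N.
exists (maxn N1 (maxn N2 N3))%:Z => -[n|//].
rewrite lez_nat !geq_max => /and3P[N1n N2n N3n].
have n0 : 0 < n%:R :> R by rewrite ltr0n (leq_trans _ N2n).
have Mn : M < n%:R.
  have: M <= (Num.ceil M)%:~R by exact: ceil_ge.
  move=> /le_lt_trans; apply; rewrite -[n%:R]/(n%:Z%:~R) ltr_int.
  by apply: (le_lt_trans (ler_norm _)); rewrite -abszE ltz_nat.
have un0 : 0 < u n%:R by rewrite (lt_le_trans ltr01)// u_ge1// ltW.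
have un : u n%:R < (2 * C)^-1 * n%:R.
  by have := uM _ Mn; rewrite sub0r normrN gtr0_norm ?divr_gt0// ltr_pdivrMr.
have := kC n N1n; rewrite /= ger0_norm ?ler0n// gtr0_norm// => kn.
have : (2 * k n%:Z)%:R <= n%:R :> R.
  rewrite natrM -ler_pdivlMl//; apply: (le_trans kn).
  rewrite -ler_pdivlMl//; apply: (le_trans (ltW un)).
  by rewrite invfM mulrA [_^-1 * _^-1]mulrC.
rewrite ler_nat => kn2.
have cn : c <= `|c|%N%:Z by rewrite abszE ler_norm.
apply: (le_trans cn); rewrite lerBrDr -PoszD lez_nat.
rewrite -(leq_pmul2l (isT : (0 < 2)%N)) mulnDr (leq_trans (leq_add N3n kn2))//.
by rewrite mul2n addnn.
Qed.

(** The rescaling of depths in [finer] is cofinal. *)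
Lemma floor_unbounded (lambda : R) (n0 n : int) : 0 < lambda ->
  exists2 N, n0 <= N & n <= Num.floor (lambda * N%:~R).
Proof.
move=> l0; exists (Num.max n0 (Num.ceil (lambda^-1 * n%:~R))).
  by rewrite le_max lexx.
rewrite floor_ge_int -ler_pdivrMl//; apply: (le_trans (ceil_ge _)).
by rewrite ler_int le_max lexx orbT.
Qed.

End Scales.

(** * Round sets, rings and measures on a single space *)

Section Monotonicity.
Variables (R : realType) (u : R -> R) (Z : Type) (B : qs_structure u Z).
Implicit Types (k l : Oplus u) (n m : int).

Lemma round_setsE k n a : round_sets B k n a <-> rings B k n (a, a).
Proof. split=> [[b [nb kb ba ab]]|[b [nb kb ba _ ab]]]; by exists b; split. Qed.

Lemma ringsS k n m : n <= m -> rings B k m `<=` rings B k n.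
Proof. by move=> nm a [b [mb *]]; exists b; split=> //; exact: le_trans mb. Qed.

Lemma outer_ringsS k n m : n <= m -> outer_rings B k m `<=` outer_rings B k n.
Proof. by move=> nm a [b [mb *]]; exists b; split=> //; exact: le_trans mb. Qed.

Lemma rings_all k n : rings B k n `<=` all_rings B k.
Proof. by move=> a [b [nb kb *]]; exists (odom k) => //=; exists b. Qed.

Lemma hat_le_delta (b b' : ball_of B) : hat b `<=` hat b' -> delta b' <= delta b.
Proof.
by move=> bb'; rewrite leNgt; apply/negP => /(sc1_iii (b:=b)); exact.
Qed.

(** The tilde gauge of a sufficiently small round set only sees deep rings: the
ball witnessing such a ring lies in k.b with b deep, and k.b is still deep by
sublinearity. *)
Lemma small_round_set_ring (u_adm : admissible u) k l n : exists N,
  forall a a', round_sets B k N a -> all_rings B l (a, a') ->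
    rings B l n (a, a').
Proof.
have [N Nk] := Oplus_sublinear u_adm k n; exists N => a a' [b [Nb _ _ ab]].
move=> [_ _ [c [_ lc ca aa' a'c]]]; exists c; split=> //.
have := hat_le_delta (subset_trans ca ab).
by rewrite sc0_delta; apply: le_trans; exact: Nk.
Qed.

(** The analogue for the inner set of an outer ring, which lies in the ball b
itself, so that no depth is lost. *)
Lemma small_outer_ring_ring j l n a a' :
  outer_rings B j n a -> all_rings B l (a.1, a') -> rings B l n (a.1, a').
Proof.
move=> [b [nb _ ab _ _]] [_ _ [c [_ lc ca aa' a'c]]]; exists c; split=> //.
exact: le_trans nb (hat_le_delta (subset_trans ca ab)).
Qed.

Lemma tilde_ge0 (phi : gauge R Z) l a : (0 <= tilde B phi l a)%E.
Proof. exact: sup0_ge0. Qed.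

Lemma covering_measure_nondecreasing (f : set Z -> \bar R) (p : R) k A :
  {homo (fun n : nat => ereal_inf
    [set \esum_(b in F) (f b `^ p)%E | F in coverings B k n%:Z A]) :
    n m / (n <= m)%N >-> (n <= m)%E}.
Proof.
move=> n m nm; apply: ereal_inf_le_tmp => _ [F [cF Fk FA] <-].
exists F => //; split=> // a /Fk/round_setsE Fa; apply/round_setsE.
by apply: ringsS Fa; rewrite lez_nat.
Qed.

Lemma packing_measure_nonincreasing (phi : gauge R Z) l (p : R) k A :
  {homo (fun n : nat => Defs.sup0
    [set \esum_(a in P) (tilde B phi l a.1 `^ p)%E | P in packings B k n%:Z A]) :
    n m / (n <= m)%N >-> (m <= n)%E}.
Proof.
move=> n m nm; apply: sup0_le => _ [P [cP Pk PA tP] <-]; eexists => //.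
exists P => //; split=> // a /Pk; apply: outer_ringsS; rewrite lez_nat//.
Qed.

End Monotonicity.

(** * Comparison along a bijection *)

Lemma preimage_cancel (X Y : Type) (h : Y -> X) (g : X -> Y) (a : set X) :
  cancel g h -> g @^-1` (h @^-1` a) = a.
Proof.
by move=> gh; apply/seteqP; split=> x; rewrite /preimage/= gh.
Qed.

Definition preimage2 (X Y : Type) (h : Y -> X) (a : set X * set X) :=
  (h @^-1` a.1, h @^-1` a.2).

Section Comparison.
Variables (R : realType) (u : R -> R) (X Y : Type).
Variables (BX : qs_structure u X) (BY : qs_structure u Y).
Variable h : Y -> X.

(** With h the identity, this is the part of [finer BY BX] about rings in which
the factor lambda is forgotten: N depends on n in an unspecified way. Round sets
need no separate clause, being the rings of the form (a, a). *)
Definition ring_comparison := forall k, exists k', forall n, exists N,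
  forall a, rings BX k N a -> rings BY k' n (preimage2 h a).

Definition outer_ring_comparison := forall k', exists k, forall n, exists N,
  forall a, outer_rings BX k N a -> outer_rings BY k' n (preimage2 h a).

Lemma tilde_le (phi : gauge R Y) l l' a :
  (forall a', all_rings BX l (a, a') ->
    all_rings BY l' (h @^-1` a, h @^-1` a')) ->
  (tilde BX (fun c => phi (h @^-1` c)) l a <= tilde BY phi l' (h @^-1` a))%E.
Proof.
move=> ll'; apply: sup0_le => _ [a' /ll' la' <-].
by eexists; [exists (h @^-1` a')|exact: lexx].
Qed.

Variable g : X -> Y.
Hypotheses (gh : cancel g h) (hg : cancel h g).

Lemma preimage_inj : injective (fun a : set X => h @^-1` a).
Proof.
by move=> a b /(congr1 (fun c => g @^-1` c)); rewrite !(preimage_cancel _ gh).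
Qed.

Lemma preimage2_inj : injective (preimage2 h).
Proof. by move=> [a a'] [b b'] [/preimage_inj -> /preimage_inj ->]. Qed.

(** Fine coverings in X are carried to coverings in Y, where the infimum is thus
over more families. *)
Lemma covering_measure_le (fX : set X -> \bar R) (fY : set Y -> \bar R)
    p kX kY A :
  0 <= p -> (forall a, 0 <= fY a)%E ->
  (forall n : int, exists N : int, forall a, round_sets BX kX N a ->
    round_sets BY kY n (h @^-1` a) /\ (fY (h @^-1` a) <= fX a)%E) ->
  (covering_measure BY fY p kY (h @^-1` A) <=
   covering_measure BX fX p kX A)%E.
Proof.
move=> p0 f0 cmp; apply: limn_nondecreasing_le;
  try exact: covering_measure_nondecreasing.
move=> n; have [N cmpN] := cmp n; exists `|N|%N.
have {}cmpN a : round_sets BX kX `|N|%N a ->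
    round_sets BY kY n (h @^-1` a) /\ (fY (h @^-1` a) <= fX a)%E.
  move=> /round_setsE aN; apply/cmpN/round_setsE; apply: ringsS aN.
  by rewrite abszE ler_norm.
apply: le_ereal_inf_tmp => _ [F [cF Fk FA] <-]; apply: ge_ereal_inf.
exists (\esum_(b in (fun a => h @^-1` a) @` F) (fY b `^ p)%E); last first.
  by apply: esum_powere_le => //; [exact: preimage_inj|move=> a /Fk/cmpN[]].
eexists => //; split.
- exact: sub_countable (card_image_le _ _) cF.
- by move=> _ [a /Fk/cmpN[]? _ <-].
- move=> y /FA[a Fa ya]; exists (h @^-1` a) => //; by exists a.
Qed.

(** Fine packings in X are carried to packings in Y, where the supremum is thus
over more families, and the tilde gauge is larger. *)
Lemma PtPhi_le (phi : gauge R Y) l l' p kX kY : 0 <= p ->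
  (forall n, exists N, forall a, outer_rings BX kX N a ->
    outer_rings BY kY n (preimage2 h a)) ->
  (exists N, forall a, rings BX l N a -> all_rings BY l' (preimage2 h a)) ->
  (PtPhi BX (fun c => phi (h @^-1` c)) l p kX setT <=
   PtPhi BY phi l' p kY setT)%E.
Proof.
move=> p0 outer [M ringM]; apply: limn_nonincreasing_le;
  try exact: packing_measure_nonincreasing.
move=> n; have [N outerN] := outer n; exists (maxn `|N| `|M|)%N.
set K := maxn _ _.
have NK : N <= K by rewrite (le_trans (ler_norm _))// -abszE lez_nat leq_maxl.
have MK : M <= K by rewrite (le_trans (ler_norm _))// -abszE lez_nat leq_maxr.
apply: sup0_le => _ [P [cP Pk PA tP] <-].
exists (\esum_(a in preimage2 h @` P) (tilde BY phi l' a.1 `^ p)%E); last first.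
  rewrite esum_image; last by move=> ? ? _ _ /preimage2_inj.
  apply: le_esum => a Pa.
  have tle : (tilde BX (fun c => phi (h @^-1` c)) l a.1 <=
      tilde BY phi l' (h @^-1` a.1))%E.
    apply: tilde_le => a' /(small_outer_ring_ring (Pk _ Pa)) aa'.
    exact: (ringM (a.1, a')) (ringsS MK aa').
  by apply: gt0_ler_poweR => //; rewrite in_itv/= leey andbT tilde_ge0.
eexists => //; split.
- exact: sub_countable (card_image_le _ _) cP.
- move=> _ [a /Pk aK <-]; apply: outerN; exact: outer_ringsS aK.
- move=> _ [a /PA[x [ax _]] <-]; exists (g x); split=> //.
  by rewrite /preimage2 /preimage/= gh.
- move=> _ _ [a Pa <-] [b Pb <-] [y [ay bY]].
  by rewrite (tP a b Pa Pb)//; exists (h y).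
Qed.

End Comparison.

(** * The dimensions increase under comparison *)

Section Dimensions.
Variables (R : realType) (u : R -> R) (X Y : Type).
Variables (BX : qs_structure u X) (BY : qs_structure u Y).
Variables (h : Y -> X) (g : X -> Y).
Hypotheses (gh : cancel g h) (hg : cancel h g).
Hypothesis u_adm : admissible u.
Hypothesis ringXY : ring_comparison BX BY h.
Hypothesis ringYX : ring_comparison BY BX g.
Hypothesis outerXY : outer_ring_comparison BX BY h.
Variables (GammaX : set (set X)) (GammaY : set (set Y)).
Hypothesis GammaXY : forall gamma, GammaX gamma -> GammaY (h @^-1` gamma).

Lemma admissible_gauges_preimage m : exists m', forall phi,
  admissible_gauges BY m' GammaY phi ->
  admissible_gauges BX m GammaX (fun c => phi (h @^-1` c)).
Proof.
have [m' mm'] := ringXY m; exists m' => phi phiY gamma /GammaXY/phiY.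
move=> /le_trans; apply; apply: (covering_measure_le gh) => // n.
have [N NP] := mm' n; exists N => a /round_setsE/NP aY; split=> //.
exact/round_setsE.
Qed.

(** Coverings are carried from Y to X whereas rings, hence tilde gauges, are
compared from X to Y; this is why comparisons in both directions are needed. The
covering sets g^-1 a are round in X, which makes their l-rings deep enough to be
compared. *)
Lemma tPhi_le (phi : gauge R Y) l l' p kX kY : 0 <= p ->
  (forall n, exists N, forall a, rings BY kY N a ->
    rings BX kX n (preimage2 g a)) ->
  (exists N, forall a, rings BX l N a -> all_rings BY l' (preimage2 h a)) ->
  (tPhi BX (fun c => phi (h @^-1` c)) l p kX setT <=
   tPhi BY phi l' p kY setT)%E.
Proof.
move=> p0 kYX [M ringM].
rewrite /tPhi -[X in covering_measure BX _ _ _ X](preimage_setT g).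
apply: (covering_measure_le hg) => // [a|n]; first exact: tilde_ge0.
have [K KP] := small_round_set_ring BX u_adm kX l M.
have [N NP] := kYX (Num.max n K); exists N => a /round_setsE/NP aX; split.
  by apply/round_setsE; apply: ringsS aX; rewrite le_max lexx.
rewrite -{2}[a](preimage_cancel _ hg); apply: tilde_le => a' aa'.
apply: (ringM (_, _)); apply: KP aa'; apply/round_setsE.
by apply: ringsS aX; rewrite le_max lexx orbT.
Qed.

Lemma Cdim_le : (Cdim BX GammaX <= Cdim BY GammaY)%E.
Proof.
apply: sup0_le => _ [p [p0 modX] <-]; exists p%:E => //; exists p => //.
split=> // kY; have [kX kYX] := ringYX kY.
have [l [m modE]] := modX kX.
have [l' ll'] := ringXY l; have [m' mm'] := admissible_gauges_preimage m.
exists l', m'; apply/ereal_inf_pinfty => _ [phi phiY <-] /=.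
apply/eqP; rewrite -leye_eq -modE; apply: le_trans (tPhi_le _ _ kYX _).
- by apply: ereal_inf_lbound; eexists => //; exact: mm'.
- exact: ltW.
(* The depth 0 is arbitrary: any target depth gives membership in [all_rings]. *)
- have [N NP] := ll' 0; exists N => a /NP; exact: rings_all.
Qed.

Lemma PCdim_le : (PCdim BX GammaX <= PCdim BY GammaY)%E.
Proof.
apply: sup0_le => _ [p [p0 modX] <-]; exists p%:E => //; exists p => //.
split=> // kY; have [kX kYX] := outerXY kY.
have [l [m modE]] := modX kX.
have [l' ll'] := ringXY l; have [m' mm'] := admissible_gauges_preimage m.
exists l', m'; apply/ereal_inf_pinfty => _ [phi phiY <-] /=.
apply/eqP; rewrite -leye_eq -modE; apply: le_trans (PtPhi_le gh _ _ kYX _).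
- by apply: ereal_inf_lbound; eexists => //; exact: mm'.
- exact: ltW.
- have [N NP] := ll' 0; exists N => a /NP; exact: rings_all.
Qed.

End Dimensions.

(** * Comparisons from a homeomorphism *)

Section Finer.
Variables (R : realType) (u : R -> R) (Z Z' : Type).
Variables (B : qs_structure u Z) (B' : qs_structure u Z').
Variables (phi : Z -> Z') (phi_bij : bijective phi).

Lemma finer_ring_comparison (B1 B2 : qs_structure u Z) :
  finer B2 B1 -> ring_comparison B1 B2 id /\ outer_ring_comparison B1 B2 id.
Proof.
move=> [lambda [n0 [l0 ring outer]]]; split=> k.
  have [k' kk'] := ring k; exists k' => n.
  have [N n0N nN] := floor_unbounded n0 n l0.
  by exists N => -[a a'] /(kk' _ n0N); exact: ringsS.
have [k' kk'] := outer k; exists k' => n.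
have [N n0N nN] := floor_unbounded n0 n l0.
by exists N => -[a a'] /(kk' _ n0N); exact: outer_ringsS.
Qed.

Lemma rings_pullback k n a :
  rings B' k n a -> rings (pullback phi_bij B') k n (preimage2 phi a).
Proof.
by move=> [b [nb kb ba aa' a'b]]; exists b; split=> //; exact: preimage_subset.
Qed.

Lemma outer_rings_pullback k n a :
  outer_rings B' k n a ->
  outer_rings (pullback phi_bij B') k n (preimage2 phi a).
Proof.
by move=> [b [nb kb ba aa' a'b]]; exists b; split=> //; exact: preimage_subset.
Qed.

Variables (psi : Z' -> Z) (psiK : cancel psi phi).

Lemma pullback_rings k n a :
  rings (pullback phi_bij B') k n a -> rings B' k n (preimage2 psi a).
Proof.
move=> [b [nb kb ba aa' a'b]]; exists b; split=> //=.
- by rewrite -[X in X `<=` _](preimage_cancel _ psiK); exact: preimage_subset.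
- exact: preimage_subset.
- rewrite -[X in _ `<=` X](preimage_cancel _ psiK); exact: preimage_subset.
Qed.

Lemma pullback_outer_rings k n a :
  outer_rings (pullback phi_bij B') k n a ->
  outer_rings B' k n (preimage2 psi a).
Proof.
move=> [b [nb kb ba aa' a'b]]; exists b; split=> //=.
- by rewrite -[X in _ `<=` X](preimage_cancel _ psiK); exact: preimage_subset.
- exact: sc1_i.
- rewrite -[X in X `<=` _](preimage_cancel _ psiK); exact: preimage_subset.
Qed.

Lemma equivalent_pullback_comparison :
  equivalent B (pullback phi_bij B') ->
  [/\ ring_comparison B B' psi, outer_ring_comparison B B' psi,
      ring_comparison B' B phi & outer_ring_comparison B' B phi].
Proof.
move=> [/finer_ring_comparison[r1 o1] /finer_ring_comparison[r2 o2]]; split=> k.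
- have [k' kk'] := r1 k; exists k' => n; have [N NP] := kk' n; exists N => a.
  by move=> /NP/pullback_rings.
- have [k' kk'] := o1 k; exists k' => n; have [N NP] := kk' n; exists N => a.
  by move=> /NP/pullback_outer_rings.
- have [k' kk'] := r2 k; exists k' => n; have [N NP] := kk' n; exists N => a.
  by move=> /rings_pullback/NP.
- have [k' kk'] := o2 k; exists k' => n; have [N NP] := kk' n; exists N => a.
  by move=> /outer_rings_pullback/NP.
Qed.

End Finer.

Theorem proposition2p13 (R : realType) (u : R -> R) (u_adm : admissible u)
    (Z Z' : Type) (B : qs_structure u Z) (B' : qs_structure u Z')
    (phi : Z -> Z') (phi_qs : qs_homeomorphism B B' phi)
    (Gamma : set (set Z)) (Gamma' : set (set Z'))
    (GammaE : Gamma' = [set phi @` gamma | gamma in Gamma]) :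
  Cdim B Gamma = Cdim B' Gamma' /\ PCdim B Gamma = PCdim B' Gamma'.
Proof.
have [phi_bij equiv] := phi_qs; have [psi phiK psiK] := phi_bij.
have [r1 o1 r2 o2] := equivalent_pullback_comparison psiK equiv.
have imE gamma : phi @` gamma = psi @^-1` gamma.
  apply/seteqP; split=> [_ [x gx <-]|y gy]; first by rewrite /preimage/= phiK.
  by exists (psi y).
have G1 gamma : Gamma gamma -> Gamma' (psi @^-1` gamma).
  by rewrite GammaE -imE => ?; exists gamma.
have G2 gamma' : Gamma' gamma' -> Gamma (phi @^-1` gamma').
  by rewrite GammaE => -[gamma ggamma <-]; rewrite imE (preimage_cancel _ phiK).
split; apply/eqP; rewrite eq_le; apply/andP; split.
- exact: (Cdim_le phiK psiK u_adm r1 r2 G1).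
- exact: (Cdim_le psiK phiK u_adm r2 r1 G2).
- exact: (PCdim_le phiK r1 o1 G1).
- exact: (PCdim_le psiK r2 o2 G2).
Qed.
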